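(* Let $\tau\in\Gamma_S^\infty$ be a tree with a unique infinite spine, and suppose that its Hausdorff dimension $d_h$, its hull dimension $\bar d_h$ and its spectral dimension $d_s$ all exist (in the strong senses defined in the context). Then $$\frac{2d_h}{1+d_h}\;\le\; d_s\;\le\;\frac{2\bar d_h}{1+\bar d_h}.$$
   Context: $\Gamma$ is the set of planar (ordered) rooted, locally finite trees whose root $r$ has degree one. $\Gamma_S^\infty\subset\Gamma$ is the set of infinite trees in $\Gamma$ containing exactly one infinite non-backtracking path starting at $r$, called the spine; its vertices, ordered away from $r$, are $s_1,s_2,s_3,\dots$ (set $s_0=r$). For a graph $G$, $|G|$ denotes its number of edges. For $R\ge1$, the ball $\mathcal B_R$ is the subgraph of $\tau$ spanned by the vertices at graph distance at most $R$ from $r$. For $i\ge1$, $\mathcal A^i$ is the connected component containing $s_i$ of the graph obtained from $\tau$ by deleting the spine edges $\{s_{i-1},s_i\}$ and $\{s_i,s_{i+1}\}$ (i.e. $s_i$ together with the finite trees attached to it). The hull $\bar{\mathcal B}_R$ is the union of the spine path from $r$ to $s_R$ and $\mathcal A^1,\dots,\mathcal A^R$; thus $|\bar{\mathcal B}_R|=R+\sum_{i=1}^R|\mathcal A^i|$ and $\mathcal B_R\subseteq\bar{\mathcal B}_R$. A positive measurable function $L$ is slowly varying at infinity if $L(\lambda R)/L(R)\to1$ as $R\to\infty$ for every $\lambda>0$; $l$ is slowly varying at $0^+$ if $x\mapsto l(1/x)$ is slowly varying at infinity. The Hausdorff dimension $d_h$ of $\tau$ exists (strong sense) if there are $R_0>0$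 and functions $\underline L,\bar L$ slowly varying at infinity such that $R^{d_h}\underline L(R)<|\mathcal B_R|<R^{d_h}\bar L(R)$ for all $R>R_0$. The hull dimension $\bar d_h$ is defined in the same way with $\bar{\mathcal B}_R$ in place of $\mathcal B_R$. Consider simple random walk on $\tau$ (at each step it jumps to a uniformly chosen neighbour), started at $r$. For $x\in(0,1]$ let $Q_\tau(x)=\sum_{t\ge0}\mathbb P(\omega(t)=r\mid\omega(0)=r)(1-x)^{t/2}$ be the generating function of return probabilities. The spectral dimension $d_s$ of $\tau$ exists (strong sense) if there are $x_0\in(0,1)$ and functions $\underline l,\bar l$ slowly varying at $0^+$ with $x^{-1+d_s/2}\underline l(x)<Q_\tau(x)<x^{-1+d_s/2}\bar l(x)$ for all $x<x_0$. *)

(* Defs.v *)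
From Stdlib Require Import Reals List Arith.
Import ListNotations.
Open Scope R_scope.

Definition open_set (U : R -> Prop) : Prop :=
  forall x, U x -> exists e, 0 < e /\ forall y, Rabs (y - x) < e -> U y.

Inductive borel : (R -> Prop) -> Prop :=
| borel_open U : open_set U -> borel U
| borel_compl A : borel A -> borel (fun x => ~ A x)
| borel_union (F : nat -> R -> Prop) :
    (forall n, borel (F n)) -> borel (fun x => exists n, F n x)
| borel_ext A B : borel A -> (forall x, A x <-> B x) -> borel B.

Definition null_set (N : R -> Prop) : Prop :=
  forall eps, 0 < eps -> exists a b : nat -> R,
    (forall n, a n <= b n) /\
    (forall x, N x -> exists n, a n < x < b n) /\
    (forall n, sum_f_R0 (fun i => b i - a i) n <= eps).

Definition lebesgue_measurable (A : R -> Prop) : Prop :=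
  exists B N, borel B /\ null_set N /\ forall x, ~ (A x <-> B x) -> N x.

Definition measurable_on_pos (L : R -> R) : Prop :=
  forall a, lebesgue_measurable (fun x => 0 < x /\ a < L x).

Definition slowly_varying_infty (L : R -> R) : Prop :=
  (forall x, 0 < x -> 0 < L x) /\ measurable_on_pos L /\
  forall lam, 0 < lam -> forall eps, 0 < eps -> exists M, forall x, M < x ->
    Rabs (L (lam * x) / L x - 1) < eps.

Definition slowly_varying_zero (l : R -> R) : Prop :=
  slowly_varying_infty (fun x => l (/ x)).

(* A locally finite graph on vertex set nat, given by ordered (planar)
   neighbour lists. *)
Definition adj (nb : nat -> list nat) (x y : nat) : Prop := In y (nb x).

Fixpoint within (a : nat -> nat -> Prop) (o : nat) (k : nat) (x : nat) : Prop :=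
  match k with
  | O => x = o
  | S k' => within a o k' x \/ exists y, within a o k' y /\ a y x
  end.

Definition is_cycle (nb : nat -> list nat) (c : list nat) : Prop :=
  (3 <= length c)%nat /\ NoDup c /\
  (forall i, (S i < length c)%nat -> adj nb (nth i c 0%nat) (nth (S i) c 0%nat)) /\
  adj nb (nth (length c - 1) c 0%nat) (nth 0 c 0%nat).

Definition is_tree (nb : nat -> list nat) (r : nat) : Prop :=
  (forall x y, adj nb x y -> adj nb y x) /\
  (forall x, ~ adj nb x x) /\
  (forall x, NoDup (nb x)) /\
  (forall x, exists k, within (adj nb) r k x) /\
  (forall c, ~ is_cycle nb c).

Definition nb_path (nb : nat -> list nat) (r : nat) (s : nat -> nat) : Prop :=
  s 0%nat = r /\ (forall i, adj nb (s i) (s (S i))) /\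
  (forall i, s (S (S i)) <> s i).

Definition in_GammaS (nb : nat -> list nat) (r : nat) : Prop :=
  is_tree nb r /\ length (nb r) = 1%nat /\
  exists s, nb_path nb r s /\ forall s', nb_path nb r s' -> forall i, s' i = s i.

Definition ball_edges (nb : nat -> list nat) (r : nat) (Rad : nat)
  (E : list (nat * nat)) : Prop :=
  NoDup E /\ forall x y, In (x, y) E <->
    ((x < y)%nat /\ adj nb x y /\ within (adj nb) r Rad x /\ within (adj nb) r Rad y).

Definition same_edge (x y a b : nat) : Prop := (x = a /\ y = b) \/ (x = b /\ y = a).

Definition adjA (nb : nat -> list nat) (s : nat -> nat) (i : nat) (x y : nat) : Prop :=
  adj nb x y /\ ~ same_edge x y (s (i - 1)%nat) (s i) /\ ~ same_edge x y (s i) (s (S i)).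

Definition inA (nb : nat -> list nat) (s : nat -> nat) (i x : nat) : Prop :=
  exists k, within (adjA nb s i) (s i) k x.

Definition hull_edge (nb : nat -> list nat) (s : nat -> nat) (Rad x y : nat) : Prop :=
  (exists i, (i < Rad)%nat /\ same_edge x y (s i) (s (S i))) \/
  (exists i, (1 <= i <= Rad)%nat /\ inA nb s i x /\ inA nb s i y /\ adjA nb s i x y).

Definition hull_edges (nb : nat -> list nat) (s : nat -> nat) (Rad : nat)
  (E : list (nat * nat)) : Prop :=
  NoDup E /\ forall x y, In (x, y) E <-> ((x < y)%nat /\ hull_edge nb s Rad x y).

(* hit t x = P(omega(t) = r | omega(0) = x) *)
Fixpoint hit (nb : nat -> list nat) (r : nat) (t : nat) (x : nat) : R :=
  match t with
  | O => if Nat.eqb x r then 1 else 0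
  | S t' => fold_right Rplus 0 (map (hit nb r t') (nb x)) / INR (length (nb x))
  end.

Definition return_prob (nb : nat -> list nat) (r t : nat) : R := hit nb r t r.

Definition Q_is (nb : nat -> list nat) (r : nat) (x q : R) : Prop :=
  infinite_sum (fun t => return_prob nb r t * Rpower (1 - x) (INR t / 2)) q.

Definition hausdorff_dim (nb : nat -> list nat) (r : nat) (dh : R) : Prop :=
  exists R0 Ll Lu, 0 < R0 /\ slowly_varying_infty Ll /\ slowly_varying_infty Lu /\
    forall Rad : nat, R0 < INR Rad -> exists E, ball_edges nb r Rad E /\
      Rpower (INR Rad) dh * Ll (INR Rad) < INR (length E) /\
      INR (length E) < Rpower (INR Rad) dh * Lu (INR Rad).

Definition hull_dim (nb : nat -> list nat) (s : nat -> nat) (dhb : R) : Prop :=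
  exists R0 Ll Lu, 0 < R0 /\ slowly_varying_infty Ll /\ slowly_varying_infty Lu /\
    forall Rad : nat, R0 < INR Rad -> exists E, hull_edges nb s Rad E /\
      Rpower (INR Rad) dhb * Ll (INR Rad) < INR (length E) /\
      INR (length E) < Rpower (INR Rad) dhb * Lu (INR Rad).

Definition spectral_dim (nb : nat -> list nat) (r : nat) (ds : R) : Prop :=
  exists x0 ll lu, 0 < x0 < 1 /\ slowly_varying_zero ll /\ slowly_varying_zero lu /\
    forall x, 0 < x < x0 -> exists q, Q_is nb r x q /\
      Rpower x (-1 + ds / 2) * ll x < q /\ q < Rpower x (-1 + ds / 2) * lu x.

(* Main.v *)
(** Put [z = sqrt (1 - x)] and let [g] be the Green function of the walk killed
    at rate [1 - z]; its value at the root is [Q(x)], and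
    [deg v * g v - z * sum_{u ~ v} g u = 1_{v = r}].  With the energy
    [B(f,h) = sum over edges of z df dh + (1 - z) sum_v deg v * f v * h v],
    this reads [B(f,g) = f r].

    Upper bound on [Q]: the total mass [sum_v deg v * g v] is at most
    [1 / (1 - z)], so [g] is on average at most [O(1 / (x |B_R|))] on the ball,
    while the energy bound [B(g,g) <= g r] limits the variation of [g] along
    a geodesic of length [R]; hence [Q = O(R + 1 / (x |B_R|))].

    Lower bound on [Q]: by Cauchy-Schwarz [1 / Q <= B(f,f)] for every finitely
    supported [f] with [f r = 1].  Taking [f = 1 - i/R] on the branch at [s_i]
    gives [1 / Q = O(1 / R + x |hull_R|)].

    Both estimates are used with [R = 2^n] and [x = R^-(1+d)]. *)
Require Import Defs.
From Stdlib Require Import Reals List Arith.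
From Stdlib Require Import Lra Lia Permutation Classical ClassicalEpsilon.
Import ListNotations.
Open Scope R_scope.

(** * Sums over vertices and edges *)

Definition rsum {A : Type} (F : A -> R) (l : list A) : R :=
  fold_right Rplus 0 (map F l).

Lemma rsum_cons {A : Type} (F : A -> R) (a : A) (l : list A) :
  rsum F (a :: l) = F a + rsum F l.
Proof. reflexivity. Qed.

Lemma rsum_app {A : Type} (F : A -> R) (l1 l2 : list A) :
  rsum F (l1 ++ l2) = rsum F l1 + rsum F l2.
Proof.
  induction l1 as [|a l1 IH]; cbn [app].
  - unfold rsum; simpl; lra.
  - rewrite !rsum_cons, IH; lra.
Qed.

Lemma rsum_ext {A : Type} (F G : A -> R) (l : list A) :
  (forall a, In a l -> F a = G a) -> rsum F l = rsum G l.
Proof.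
  induction l as [|a l IH]; intros H; [reflexivity|].
  rewrite !rsum_cons, IH, (H a); auto with datatypes.
Qed.

Lemma rsum_le {A : Type} (F G : A -> R) (l : list A) :
  (forall a, In a l -> F a <= G a) -> rsum F l <= rsum G l.
Proof.
  induction l as [|a l IH]; intros H; [unfold rsum; simpl; lra|].
  rewrite !rsum_cons.
  specialize (H a (in_eq _ _)) as Ha.
  assert (rsum F l <= rsum G l) by (apply IH; auto with datatypes).
  lra.
Qed.

Lemma rsum_const {A : Type} (c : R) (l : list A) :
  rsum (fun _ => c) l = INR (length l) * c.
Proof.
  induction l as [|a l IH]; [unfold rsum; simpl; lra|].
  rewrite rsum_cons, IH; cbn [length]; rewrite S_INR; lra.
Qed.

Lemma rsum_nonneg {A : Type} (F : A -> R) (l : list A) :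
  (forall a, In a l -> 0 <= F a) -> 0 <= rsum F l.
Proof.
  intros H; replace 0 with (rsum (fun _ : A => 0) l) by (rewrite rsum_const; lra).
  now apply rsum_le.
Qed.

Lemma rsum_plus {A : Type} (F G : A -> R) (l : list A) :
  rsum (fun a => F a + G a) l = rsum F l + rsum G l.
Proof.
  induction l as [|a l IH]; [unfold rsum; simpl; lra|].
  rewrite !rsum_cons, IH; lra.
Qed.

Lemma rsum_scal {A : Type} (c : R) (F : A -> R) (l : list A) :
  rsum (fun a => c * F a) l = c * rsum F l.
Proof.
  induction l as [|a l IH]; [unfold rsum; simpl; lra|].
  rewrite !rsum_cons, IH; lra.
Qed.

Lemma rsum_map {A B : Type} (h : A -> B) (F : B -> R) (l : list A) :
  rsum F (map h l) = rsum (fun a => F (h a)) l.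
Proof. unfold rsum; now rewrite map_map. Qed.

Lemma rsum_Permutation {A : Type} (F : A -> R) (l l' : list A) :
  Permutation l l' -> rsum F l = rsum F l'.
Proof. induction 1; rewrite ?rsum_cons in *; lra. Qed.

(** Each entry of [l] with a nonzero value is cut out of [l'] once; the absence of repetitions in
    [l] keeps the later entries available. Asking inclusion only for nonzero terms lets [l'] cover
    just the support of [F]. *)
Lemma rsum_incl_le {A : Type} (F : A -> R) (l l' : list A) :
  NoDup l -> (forall a, In a l' -> 0 <= F a) ->
  (forall a, In a l -> F a <> 0 -> In a l') -> rsum F l <= rsum F l'.
Proof.
  revert l'; induction l as [|a l IH]; intros l' Hn Hp Hi.
  - now apply rsum_nonneg.
  - rewrite rsum_cons; inversion_clear Hn as [|? ? Ha Hl].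
    destruct (Req_dec_T (F a) 0) as [E|E].
    + rewrite E, Rplus_0_l; apply IH; auto with datatypes.
    + destruct (in_split a l' (Hi a (in_eq _ _) E)) as (l1 & l2 & ->).
      rewrite rsum_app, rsum_cons.
      enough (rsum F l <= rsum F (l1 ++ l2)) by (rewrite rsum_app in *; lra).
      apply IH; auto.
      * intros b Hb; apply Hp; rewrite in_app_iff in *; simpl; tauto.
      * intros b Hb Eb; specialize (Hi b (in_cons _ _ _ Hb) Eb).
        rewrite in_app_iff in *; simpl in Hi.
        destruct Hi as [Hi|[->|Hi]]; tauto.
Qed.

(** Dropping the zero terms leaves two duplicate-free lists with the same elements, hence
    permutations of each other. *)
Lemma rsum_support_eq {A : Type} (F : A -> R) (l l' : list A) :
  NoDup l -> NoDup l' -> (forall a, F a <> 0 -> In a l <-> In a l') ->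
  rsum F l = rsum F l'.
Proof.
  intros Hl Hl' H.
  set (p := fun a => if Req_dec_T (F a) 0 then false else true).
  assert (Hf : forall k, rsum F k = rsum F (filter p k)).
  { induction k as [|a k IH]; [reflexivity|].
    cbn [filter]; unfold p at 1; destruct (Req_dec_T (F a) 0) as [E|E];
      rewrite ?rsum_cons, IH; lra. }
  rewrite (Hf l), (Hf l'); apply rsum_Permutation, NoDup_Permutation;
    [now apply NoDup_filter..|].
  intros a; rewrite !filter_In; unfold p.
  destruct (Req_dec_T (F a) 0) as [E|E]; [intuition discriminate|].
  specialize (H a E); tauto.
Qed.

(** Edges are oriented here: one inside [V] counts twice, one leaving [V] counts once. *)
Definition edge_sum (nb : nat -> list nat) (V : list nat) (F : nat -> nat -> R) : R :=
  rsum (fun v => rsum (F v) (nb v)) V.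

Definition edge_list (nb : nat -> list nat) (V : list nat) : list (nat * nat) :=
  flat_map (fun v => map (pair v) (nb v)) V.

Lemma in_edge_list nb V v u : In (v, u) (edge_list nb V) <-> In v V /\ In u (nb v).
Proof.
  unfold edge_list; rewrite in_flat_map; split.
  - intros (x & Hx & H); rewrite in_map_iff in H; destruct H as (y & E & Hy).
    now inversion E; subst.
  - intros [Hv Hu]; exists v; split; [easy|]; now apply in_map.
Qed.

Lemma NoDup_edge_list nb V :
  (forall x, NoDup (nb x)) -> NoDup V -> NoDup (edge_list nb V).
Proof.
  intros Hnb; induction 1 as [|v V Hv HV IH]; [constructor|].
  apply NoDup_app; [|exact IH|].
  - apply FinFun.Injective_map_NoDup; [|apply Hnb].
    intros a b E; now inversion E.
  - intros [a b] H H'; apply in_edge_list in H'.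
    rewrite in_map_iff in H; destruct H as (y & E & _); inversion E; subst; tauto.
Qed.

Lemma edge_sum_list nb V F :
  edge_sum nb V F = rsum (fun e => F (fst e) (snd e)) (edge_list nb V).
Proof.
  unfold edge_sum, edge_list; induction V as [|v V IH]; [reflexivity|].
  cbn [flat_map]; now rewrite rsum_app, rsum_map, rsum_cons, IH.
Qed.

Lemma edge_sum_ext nb V F G :
  (forall v u, In v V -> In u (nb v) -> F v u = G v u) ->
  edge_sum nb V F = edge_sum nb V G.
Proof. intros H; apply rsum_ext; intros; apply rsum_ext; auto. Qed.

Lemma edge_sum_plus nb V F G :
  edge_sum nb V (fun v u => F v u + G v u) = edge_sum nb V F + edge_sum nb V G.
Proof. rewrite !edge_sum_list; apply rsum_plus. Qed.

Lemma edge_sum_scal nb V c F :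
  edge_sum nb V (fun v u => c * F v u) = c * edge_sum nb V F.
Proof. rewrite !edge_sum_list; apply rsum_scal. Qed.

Lemma edge_sum_nonneg nb V F :
  (forall v u, 0 <= F v u) -> 0 <= edge_sum nb V F.
Proof. intros H; apply rsum_nonneg; intros; apply rsum_nonneg; auto. Qed.

(** Reversal permutes the oriented edges with both ends in [V], and the last hypothesis makes [F]
    vanish on the edges that leave [V]. *)
Lemma edge_sum_swap nb V F :
  (forall x y, adj nb x y -> adj nb y x) -> (forall x, NoDup (nb x)) -> NoDup V ->
  (forall v u, In u (nb v) -> F v u <> 0 -> In v V /\ In u V) ->
  edge_sum nb V F = edge_sum nb V (fun v u => F u v).
Proof.
  intros Hs Hnb HV HF; rewrite !edge_sum_list.
  transitivity (rsum (fun e => F (fst e) (snd e))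
    (map (fun e => (snd e, fst e)) (edge_list nb V))).
  2: { rewrite rsum_map; now apply rsum_ext. }
  apply rsum_support_eq.
  - now apply NoDup_edge_list.
  - apply FinFun.Injective_map_NoDup; [|now apply NoDup_edge_list].
    intros [a b] [c d] E; now inversion E.
  - intros [v u] E; cbn [fst snd] in E; rewrite in_map_iff, in_edge_list; split.
    + intros [Hv Hu]; exists (u, v); rewrite in_edge_list; split; [easy|].
      split; [now apply (HF v u)|now apply Hs].
    + intros ([a b] & Ee & H); inversion Ee; subst; apply in_edge_list in H.
      assert (In u (nb v)) by (apply Hs; apply H).
      split; [|easy]; now apply (HF v u).
Qed.

(** The factor [z / 2] compensates for the two orientations of an edge; summing the second term over
    neighbours produces the degree weight. *)
Definition bform (nb : nat -> list nat) (V : list nat) (z : R) (f h : nat -> R) : R :=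
  edge_sum nb V (fun v u =>
    z / 2 * ((f v - f u) * (h v - h u)) + (1 - z) * (f v * h v)).

Definition lap (nb : nat -> list nat) (z : R) (h : nat -> R) (v : nat) : R :=
  rsum (fun u => h v - z * h u) (nb v).

(** Discrete summation by parts. The support hypotheses put every edge meeting the support of [f]
    inside [V], so no boundary term appears. *)
Lemma green_identity nb V z f h :
  (forall x y, adj nb x y -> adj nb y x) -> (forall x, NoDup (nb x)) -> NoDup V ->
  (forall v, f v <> 0 -> In v V) ->
  (forall v u, f v <> 0 -> In u (nb v) -> In u V) ->
  bform nb V z f h = rsum (fun v => f v * lap nb z h v) V.
Proof.
  intros Hs Hnb HV Hf Hfn; unfold bform.
  (* The two integrands differ by [K u v - K v u], which sums to zero by reversal. *)
  set (K := fun v u => z / 2 * (f v * (h v - h u))).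
  assert (HK : edge_sum nb V K = edge_sum nb V (fun v u => K u v)).
  { apply edge_sum_swap; auto.
    intros v u Hu HK; assert (f v <> 0) by (intros E; apply HK; unfold K; rewrite E; lra).
    eauto. }
  transitivity (edge_sum nb V (fun v u => f v * (h v - z * h u)) +
    (edge_sum nb V (fun v u => K u v) + -1 * edge_sum nb V K)).
  - rewrite <- edge_sum_scal, <- !edge_sum_plus; apply edge_sum_ext.
    intros; unfold K; field.
  - rewrite <- HK.
    enough (edge_sum nb V (fun v u => f v * (h v - z * h u)) =
      rsum (fun v => f v * lap nb z h v) V) by lra.
    apply rsum_ext; intros; apply rsum_scal.
Qed.

Lemma bform_sub nb V z lam f g :
  bform nb V z (fun v => g v - lam * f v) (fun v => g v - lam * f v) =
  bform nb V z g g - 2 * lam * bform nb V z f g + lam * lam * bform nb V z f f.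
Proof.
  unfold bform.
  transitivity (edge_sum nb V (fun v u =>
    z / 2 * ((g v - g u) * (g v - g u)) + (1 - z) * (g v * g v)) +
    ((- (2 * lam)) * edge_sum nb V (fun v u =>
    z / 2 * ((f v - f u) * (g v - g u)) + (1 - z) * (f v * g v)) +
     (lam * lam) * edge_sum nb V (fun v u =>
    z / 2 * ((f v - f u) * (f v - f u)) + (1 - z) * (f v * f v)))).
  - rewrite <- !edge_sum_scal, <- !edge_sum_plus; apply edge_sum_ext; intros; lra.
  - lra.
Qed.

Lemma bform_nonneg nb V z f : 0 <= z <= 1 -> 0 <= bform nb V z f f.
Proof.
  intros Hz; apply edge_sum_nonneg; intros v u.
  pose proof (Rle_0_sqr (f v - f u)) as H1; pose proof (Rle_0_sqr (f v)) as H2.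
  unfold Rsqr in *; nra.
Qed.

(** * The truncated Green function *)

Fixpoint ball (nb : nat -> list nat) (r k : nat) : list nat :=
  match k with
  | O => [r]
  | S k' => nodup Nat.eq_dec (ball nb r k' ++ flat_map nb (ball nb r k'))
  end.

Lemma NoDup_ball nb r k : NoDup (ball nb r k).
Proof. destruct k; [repeat constructor; simpl; tauto|apply NoDup_nodup]. Qed.

Lemma in_ball nb r k x : In x (ball nb r k) <-> within (adj nb) r k x.
Proof.
  revert x; induction k as [|k IH]; intros x; cbn [ball within].
  - simpl; intuition.
  - rewrite nodup_In, in_app_iff, in_flat_map, IH; unfold adj.
    split; (intros [H|(y & Hy & H)]; [now left|right; exists y; split; auto; now apply IH]).
Qed.

Lemma within_le (a : nat -> nat -> Prop) o k m x :
  (k <= m)%nat -> within a o k x -> within a o m x.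
Proof. induction 1; cbn [within]; auto. Qed.

Lemma degree_pos nb r x :
  is_tree nb r -> length (nb r) = 1%nat -> (0 < length (nb x))%nat.
Proof.
  intros (Hs & _ & _ & Hc & _) Hr.
  assert (H : forall k y, within (adj nb) r k y -> (0 < length (nb y))%nat).
  { induction k as [|k IH]; cbn [within]; intros y.
    - intros ->; lia.
    - intros [H|(w & _ & H)]; [auto|].
      apply Hs in H; unfold adj in H; destruct (nb y); simpl in *; [tauto|lia]. }
  destruct (Hc x) as [k Hk]; eauto.
Qed.

Lemma hit_nonneg nb r t x : 0 <= hit nb r t x.
Proof.
  revert x; induction t as [|t IH]; intros x; cbn [hit].
  - destruct (Nat.eqb x r); lra.
  - destruct (length (nb x)) eqn:E.
    + simpl INR; unfold Rdiv; rewrite Rinv_0; lra.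
    + apply Rmult_le_pos; [|left; apply Rinv_0_lt_compat, lt_0_INR; lia].
      apply (rsum_nonneg (hit nb r t)); auto.
Qed.

Lemma hit_support nb r t x :
  is_tree nb r -> hit nb r t x <> 0 -> within (adj nb) r t x.
Proof.
  intros (Hs & _); revert x; induction t as [|t IH]; intros x; cbn [hit within].
  - destruct (Nat.eqb_spec x r); [auto|lra].
  - intros H; right; apply NNPP; intros Hn; apply H.
    replace (fold_right Rplus 0 (map (hit nb r t) (nb x))) with 0; [unfold Rdiv; lra|].
    change (0 = rsum (hit nb r t) (nb x)).
    rewrite (rsum_ext _ (fun _ => 0)); [rewrite rsum_const; lra|].
    intros y Hy; apply NNPP; intros E; apply Hn; exists y; split; [now apply IH|].
    now apply Hs.
Qed.

Lemma hit_S nb r t x : (0 < length (nb x))%nat ->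
  INR (length (nb x)) * hit nb r (S t) x = rsum (hit nb r t) (nb x).
Proof.
  intros H; cbn [hit]; fold (rsum (hit nb r t) (nb x)).
  field; apply not_0_INR; lia.
Qed.

(** Reversibility with respect to the degree: as the root has degree one, each summand is the
    probability of going from [r] to [v] in [t] steps. The condition [t < K] keeps all vertices
    reachable by then inside the ball. *)
Lemma hit_mass nb r t K :
  is_tree nb r -> length (nb r) = 1%nat -> (t < K)%nat ->
  rsum (fun v => INR (length (nb v)) * hit nb r t v) (ball nb r K) = 1.
Proof.
  intros Ht Hr; pose proof Ht as (Hs & _ & Hnd & _).
  induction t as [|t IH]; intros HK.
  - rewrite (rsum_support_eq _ _ [r]).
    + unfold rsum; simpl; rewrite Nat.eqb_refl, Hr; simpl; lra.
    + apply NoDup_ball.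
    + repeat constructor; simpl; tauto.
    + intros a Ha; cbn [hit] in Ha; destruct (Nat.eqb_spec a r) as [E|]; [subst a|lra].
      split; [simpl; auto|intros _; apply in_ball, (within_le _ _ 0); [lia|reflexivity]].
  - rewrite <- IH by lia.
    rewrite (rsum_ext _ (fun v => rsum (hit nb r t) (nb v))).
    2: { intros v _; apply hit_S; eapply degree_pos; eauto. }
    change (edge_sum nb (ball nb r K) (fun v u => hit nb r t u) = 
      rsum (fun v => INR (length (nb v)) * hit nb r t v) (ball nb r K)).
    rewrite <- (edge_sum_swap nb (ball nb r K) (fun v u => hit nb r t v)).
    + apply rsum_ext; intros; apply rsum_const.
    + auto.
    + auto.
    + apply NoDup_ball.
    + intros v u Hu E; apply hit_support in E; [|easy].
      rewrite !in_ball; split; [apply (within_le _ _ t); [lia|easy]|].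
      apply (within_le _ _ (S t)); [lia|]; right; now exists v.
Qed.

(* Truncated at time [T] so that it has finite support. *)
Definition green (nb : nat -> list nat) (r : nat) (z : R) (T v : nat) : R :=
  sum_f_R0 (fun t => z ^ t * hit nb r t v) T.

Lemma green_S nb r z T v :
  green nb r z (S T) v = green nb r z T v + z ^ S T * hit nb r (S T) v.
Proof. reflexivity. Qed.

Lemma green_nonneg nb r z T v : 0 <= z -> 0 <= green nb r z T v.
Proof.
  intros Hz; apply cond_pos_sum; intros t.
  apply Rmult_le_pos; [now apply pow_le|apply hit_nonneg].
Qed.

Lemma green_support nb r z T v :
  is_tree nb r -> green nb r z T v <> 0 -> within (adj nb) r T v.
Proof.
  intros Ht; induction T as [|T IH].
  - unfold green; cbn [sum_f_R0]; intros H; apply (hit_support nb r 0); [easy|].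
    intros E; apply H; cbn [pow]; rewrite E; lra.
  - rewrite green_S; intros H.
    destruct (Req_dec_T (green nb r z T v) 0) as [E|E]; [|left; auto].
    apply (hit_support nb r (S T)); [easy|]; intros E'; apply H; rewrite E, E'; lra.
Qed.

(** By the first-step equation [hit_S] consecutive terms cancel; the source at [r] and one last
    term, due to the truncation, survive. *)
Lemma lap_green nb r z T v :
  is_tree nb r -> length (nb r) = 1%nat ->
  lap nb z (green nb r z T) v =
  (if Nat.eqb v r then 1 else 0) -
  z ^ S T * (INR (length (nb v)) * hit nb r (S T) v).
Proof.
  intros Ht Hr; pose proof (degree_pos nb r v Ht Hr) as Hv.
  assert (E : lap nb z (green nb r z T) v =
    INR (length (nb v)) * green nb r z T v - z * rsum (green nb r z T) (nb v)).
  { unfold lap; rewrite <- rsum_const.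
    transitivity (rsum (fun _ => green nb r z T v) (nb v) +
      - z * rsum (green nb r z T) (nb v)); [|lra].
    rewrite <- rsum_scal, <- rsum_plus; apply rsum_ext; intros; lra. }
  rewrite E; clear E; induction T as [|T IH].
  - rewrite hit_S by easy.
    replace (rsum (green nb r z 0) (nb v)) with (rsum (hit nb r 0) (nb v)).
    2: { apply rsum_ext; intros; unfold green; simpl; lra. }
    unfold green; cbn [sum_f_R0 hit pow].
    destruct (Nat.eqb_spec v r) as [->|]; [rewrite Hr|]; simpl; lra.
  - rewrite hit_S by easy.
    replace (rsum (green nb r z (S T)) (nb v)) with
      (rsum (green nb r z T) (nb v) + z ^ S T * rsum (hit nb r (S T)) (nb v)).
    2: { rewrite <- rsum_scal, <- rsum_plus; apply rsum_ext; intros.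
         now rewrite green_S. }
    rewrite green_S.
    transitivity ((INR (length (nb v)) * green nb r z T v -
      z * rsum (green nb r z T) (nb v)) +
      z ^ S T * (INR (length (nb v)) * hit nb r (S T) v) -
      z ^ S (S T) * rsum (hit nb r (S T)) (nb v)).
    + cbn [pow]; ring.
    + rewrite IH; ring.
Qed.

Lemma rsum_root nb r (F : nat -> R) K :
  rsum (fun v => F v * (if Nat.eqb v r then 1 else 0)) (ball nb r K) = F r.
Proof.
  rewrite (rsum_support_eq _ _ [r]).
  - unfold rsum; simpl; rewrite Nat.eqb_refl; lra.
  - apply NoDup_ball.
  - repeat constructor; simpl; tauto.
  - intros a Ha; destruct (Nat.eqb_spec a r) as [E|]; [subst a|lra].
    split; [simpl; auto|intros _; apply in_ball, (within_le _ _ 0); [lia|reflexivity]].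
Qed.

(** The reproducing property of the Green function, with the truncation error kept exactly. Radius
    [S K] makes room for the neighbours of the support of [f]. *)
Lemma bform_green nb r z T K f :
  is_tree nb r -> length (nb r) = 1%nat ->
  (forall v, f v <> 0 -> within (adj nb) r K v) ->
  bform nb (ball nb r (S K)) z f (green nb r z T) =
  f r - z ^ S T *
    rsum (fun v => f v * (INR (length (nb v)) * hit nb r (S T) v)) (ball nb r (S K)).
Proof.
  intros Ht Hr Hf; pose proof Ht as (Hs & _ & Hnd & _).
  rewrite green_identity; auto using NoDup_ball.
  - rewrite (rsum_ext _ (fun v => f v * (if Nat.eqb v r then 1 else 0) +
      - z ^ S T * (f v * (INR (length (nb v)) * hit nb r (S T) v)))).
    + rewrite rsum_plus, rsum_scal, rsum_root; lra.
    + intros; rewrite lap_green by easy; ring.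
  - intros v Hv; apply in_ball; left; auto.
  - intros v u Hv Hu; apply in_ball; right; exists v; split; auto.
Qed.

Lemma bform_green_self nb r z T K :
  is_tree nb r -> length (nb r) = 1%nat -> 0 <= z -> (T <= K)%nat ->
  bform nb (ball nb r (S K)) z (green nb r z T) (green nb r z T) <= green nb r z T r.
Proof.
  intros Ht Hr Hz HK; rewrite bform_green; auto.
  - enough (0 <= z ^ S T * rsum (fun v => green nb r z T v *
      (INR (length (nb v)) * hit nb r (S T) v)) (ball nb r (S K))) by lra.
    apply Rmult_le_pos; [now apply pow_le|]; apply rsum_nonneg; intros.
    apply Rmult_le_pos; [now apply green_nonneg|].
    apply Rmult_le_pos; [apply pos_INR|apply hit_nonneg].
  - intros v Hv; eapply within_le; [exact HK|]; eapply green_support; eauto.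
Qed.

(** By [hit_mass] each time [t] contributes mass [z ^ t], so the total is a partial geometric
    series. *)
Lemma green_mass nb r z T K :
  is_tree nb r -> length (nb r) = 1%nat -> 0 <= z < 1 -> (T < K)%nat ->
  rsum (fun v => INR (length (nb v)) * green nb r z T v) (ball nb r K) <= / (1 - z).
Proof.
  intros Ht Hr Hz HK.
  assert (E : (1 - z) * rsum (fun v => INR (length (nb v)) * green nb r z T v) (ball nb r K)
    = 1 - z ^ S T).
  { induction T as [|T IH].
    - rewrite (rsum_ext _ (fun v => INR (length (nb v)) * hit nb r 0 v)).
      + rewrite hit_mass by easy; simpl; ring.
      + intros; unfold green; simpl; ring.
    - rewrite (rsum_ext _ (fun v => INR (length (nb v)) * green nb r z T v +
        z ^ S T * (INR (length (nb v)) * hit nb r (S T) v))).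
      + rewrite rsum_plus, rsum_scal, hit_mass, Rmult_plus_distr_l, IH by (easy || lia).
        cbn [pow]; ring.
      + intros; rewrite green_S; ring. }
  apply (Rmult_le_reg_l (1 - z)); [lra|]; rewrite E, Rinv_r by lra.
  pose proof (pow_le z (S T)); lra.
Qed.

(** * Energy estimates *)

(* Each step of a geodesic is bounded by AM-GM; vertices of distinct depth
   carry disjoint parts of the Dirichlet sum. *)
Lemma geodesic_variation nb r g lam k v :
  is_tree nb r -> 0 < lam -> within (adj nb) r k v ->
  exists l, NoDup l /\ (forall y, In y l -> within (adj nb) r k y) /\
    g r - g v <= INR k * (lam / 2) +
      / (2 * lam) * edge_sum nb l (fun y u => (g y - g u) * (g y - g u)).
Proof.
  intros (Hs & _) Hlam; revert v; induction k as [|k IH]; intros v Hv.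
  - exists []; cbn in Hv; subst v; split; [constructor|]; split; [simpl; tauto|].
    unfold edge_sum, rsum; simpl; lra.
  - rewrite S_INR.
    destruct (classic (within (adj nb) r k v)) as [H|H].
    + destruct (IH v H) as (l & Hl & Hw & Hg); exists l; split; [easy|].
      split; [intros y Hy; left; auto|]; lra.
    + destruct Hv as [Hv|(y & Hy & Hyv)]; [tauto|].
      destruct (IH y Hy) as (l & Hl & Hw & Hg); exists (v :: l); split; [|split].
      * constructor; auto.
      * intros w [<-|Hw']; [right; eauto|left; auto].
      * unfold edge_sum in *; rewrite rsum_cons, Rmult_plus_distr_l.
        enough (g y - g v <= lam / 2 +
          / (2 * lam) * rsum (fun u => (g v - g u) * (g v - g u)) (nb v)) by lra.
        assert (Hy1 : (g v - g y) * (g v - g y) <=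
          rsum (fun u => (g v - g u) * (g v - g u)) (nb v)).
        { transitivity (rsum (fun u => (g v - g u) * (g v - g u)) [y]);
            [unfold rsum; simpl; lra|].
          apply rsum_incl_le.
          - repeat constructor; simpl; tauto.
          - intros; apply Rle_0_sqr.
          - intros a [<-|[]] _; now apply Hs. }
        apply (Rmult_le_compat_l (/ (2 * lam))) in Hy1;
          [|left; apply Rinv_0_lt_compat; lra].
        enough (g y - g v <= lam / 2 + / (2 * lam) * ((g v - g y) * (g v - g y))) by lra.
        apply (Rmult_le_reg_l (2 * lam)); [lra|].
        rewrite Rmult_plus_distr_l, <- Rmult_assoc, Rinv_r by lra.
        pose proof (Rle_0_sqr (lam - (g y - g v))) as Hq; unfold Rsqr in Hq; lra.
Qed.

Lemma edge_list_length nb V :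
  INR (length (edge_list nb V)) = rsum (fun v => INR (length (nb v))) V.
Proof.
  unfold edge_list; induction V as [|v V IH]; [reflexivity|].
  cbn [flat_map]; now rewrite length_app, length_map, plus_INR, IH, rsum_cons.
Qed.

Lemma ball_edges_le nb r Rad E :
  ball_edges nb r Rad E ->
  INR (length E) <= rsum (fun v => INR (length (nb v))) (ball nb r Rad).
Proof.
  intros [HE H]; rewrite <- edge_list_length; apply le_INR, NoDup_incl_length; [easy|].
  intros [x y] Hxy; apply H in Hxy; apply in_edge_list; rewrite in_ball; tauto.
Qed.

(** The energy is at most [g r], so the variation along a path from the root costs a multiple of
    [g r], which is absorbed on the left. *)
Lemma green_root_le nb r z T Rad v :
  is_tree nb r -> length (nb r) = 1%nat -> 0 < z < 1 ->
  within (adj nb) r Rad v ->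
  green nb r z T r <= 2 * INR Rad / z + 2 * green nb r z T v.
Proof.
  intros Ht Hr Hz Hv; set (g := green nb r z T).
  (* With [2 / z] the Dirichlet sum gets the factor [z / 4], half of its factor in the energy, so
     the variation costs at most [g r / 2] beyond [INR Rad / z]. *)
  destruct (geodesic_variation nb r g (2 / z) Rad v) as (l & Hl & Hw & Hg); auto.
  { apply Rdiv_lt_0_compat; lra. }
  pose proof (bform_green_self nb r z T (Nat.max T Rad) Ht Hr ltac:(lra) ltac:(lia)) as HB.
  fold g in HB; set (V := ball nb r (S (Nat.max T Rad))) in *.
  set (D := fun y u => (g y - g u) * (g y - g u)) in *.
  assert (HD : edge_sum nb l D <= edge_sum nb V D).
  { apply rsum_incl_le; [easy| |].
    - intros; apply rsum_nonneg; intros; apply Rle_0_sqr.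
    - intros a Ha _; apply in_ball, (within_le _ _ Rad); [lia|auto]. }
  assert (HDB : z / 2 * edge_sum nb V D <= bform nb V z g g).
  { unfold bform.
    rewrite edge_sum_plus, edge_sum_scal; fold D.
    enough (0 <= edge_sum nb V (fun v _ => (1 - z) * (g v * g v))) by lra.
    apply edge_sum_nonneg; intros w _; apply Rmult_le_pos; [lra|apply Rle_0_sqr]. }
  replace (/ (2 * (2 / z))) with (z / 2 / 2) in Hg by (field; lra).
  replace (INR Rad * (2 / z / 2)) with (INR Rad / z) in Hg by (field; lra).
  replace (2 * INR Rad / z) with (2 * (INR Rad / z)) by (field; lra).
  assert (z / 2 * edge_sum nb l D <= z / 2 * edge_sum nb V D)
    by (apply Rmult_le_compat_l; lra).
  lra.
Qed.

(** Averages [green_root_le] over the ball with degree weights: the total weight is at least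
    [length E], while [green_mass] bounds the weighted sum. *)
Lemma green_upper nb r z T Rad E :
  is_tree nb r -> length (nb r) = 1%nat -> 0 < z < 1 ->
  ball_edges nb r Rad E -> (0 < length E)%nat ->
  green nb r z T r <= 2 * INR Rad / z + 2 / ((1 - z) * INR (length E)).
Proof.
  intros Ht Hr Hz HE HE0; set (g := green nb r z T).
  set (c := 2 * INR Rad / z); set (B := ball nb r Rad).
  pose proof (ball_edges_le _ _ _ _ HE) as HW; fold B in HW.
  set (W := rsum (fun v => INR (length (nb v))) B) in *.
  apply lt_0_INR in HE0.
  assert (Hm : rsum (fun v => INR (length (nb v)) * g v) B <= / (1 - z)).
  { rewrite <- (green_mass nb r z T (S (Nat.max T Rad)) Ht Hr ltac:(lra) ltac:(lia)).
    fold g; apply rsum_incl_le; [apply NoDup_ball| |].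
    - intros; apply Rmult_le_pos; [apply pos_INR|apply green_nonneg; lra].
    - intros a Ha _; apply in_ball in Ha; apply in_ball, (within_le _ _ Rad); [lia|easy]. }
  assert (H : (g r - c) * W <= 2 * / (1 - z)).
  { transitivity (2 * rsum (fun v => INR (length (nb v)) * g v) B); [|lra].
    unfold W; rewrite <- !rsum_scal; apply rsum_le; intros v Hv.
    apply in_ball in Hv.
    pose proof (green_root_le nb r z T Rad v Ht Hr Hz Hv) as Hg; fold g c in Hg.
    pose proof (pos_INR (length (nb v))); nra. }
  assert (Hz' : 0 < / (1 - z)) by (apply Rinv_0_lt_compat; lra).
  enough ((g r - c) * INR (length E) <= 2 * / (1 - z)) as H'.
  { apply (Rmult_le_compat_r (/ INR (length E))) in H';
      [|left; now apply Rinv_0_lt_compat].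
    rewrite Rmult_assoc, Rinv_r, Rmult_1_r in H' by lra.
    replace (2 / ((1 - z) * INR (length E))) with (2 * / (1 - z) * / INR (length E))
      by (field; lra).
    lra. }
  (* Replacing [W] by the smaller [INR (length E)] is sound when [g r - c] is positive; otherwise
     the left side is at most zero. *)
  destruct (Rle_dec (g r - c) 0); nra.
Qed.

(** Cauchy-Schwarz in the form [B(g - lam f, g - lam f) >= 0], expanded. The multiplier stays free
    so that it can later be the limit [Q(x)], independently of [T]. *)
Lemma green_lower nb r z f c :
  is_tree nb r -> length (nb r) = 1%nat -> 0 < z < 1 ->
  (exists K, forall v, f v <> 0 -> within (adj nb) r K v) ->
  (forall v, 0 <= f v <= 1) -> f r = 1 ->
  (forall V, NoDup V -> bform nb V z f f <= c) ->
  forall T lam, 0 <= lam ->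
    2 * lam * (1 - z ^ S T) <= green nb r z T r + lam * lam * c.
Proof.
  intros Ht Hr Hz [K0 HK0] Hf Hfr Hc T lam Hlam.
  set (K := (S (Nat.max T K0))); set (g := green nb r z T).
  assert (HK : forall v, f v <> 0 -> within (adj nb) r K v).
  { intros v Hv; apply (within_le _ _ K0); [unfold K; lia|auto]. }
  pose proof (bform_nonneg nb (ball nb r (S K)) z (fun v => g v - lam * f v)
    ltac:(lra)) as H.
  rewrite bform_sub in H.
  pose proof (bform_green_self nb r z T K Ht Hr ltac:(lra) ltac:(unfold K; lia)) as Hg.
  pose proof (bform_green nb r z T K f Ht Hr HK) as Hgf; fold g in Hg, Hgf.
  specialize (Hc _ (NoDup_ball nb r (S K))).
  (* Since [f <= 1], the truncation error in [B(f,g)] is at most [z ^ S T] times the unit mass of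
     the walk at time [S T]. *)
  assert (Hm : rsum (fun v => f v * (INR (length (nb v)) * hit nb r (S T) v))
    (ball nb r (S K)) <= 1).
  { rewrite <- (hit_mass nb r (S T) (S K)); auto; [|unfold K; lia].
    apply rsum_le; intros v _.
    assert (0 <= INR (length (nb v)) * hit nb r (S T) v)
      by (apply Rmult_le_pos; [apply pos_INR|apply hit_nonneg]).
    specialize (Hf v); nra. }
  rewrite Hfr in Hgf.
  assert (Hb : 1 - z ^ S T <= bform nb (ball nb r (S K)) z f g).
  { pose proof (pow_lt z (S T) ltac:(lra)); nra. }
  assert (lam * lam * bform nb (ball nb r (S K)) z f f <= lam * lam * c)
    by (apply Rmult_le_compat_l; nra).
  nra.
Qed.

(** * The hull and its test function *)

(** Extending only when [x] is not already within [k] steps keeps the path simple, as the earlier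
    vertices are. The list runs from [x] back to [o], hence the reversed indices in the last
    clause. *)
Lemma within_simple_path (a : nat -> nat -> Prop) o k x :
  within a o k x -> exists p, NoDup p /\ (forall y, In y p -> within a o k y) /\
    (0 < length p)%nat /\ nth 0 p 0%nat = x /\ nth (length p - 1) p 0%nat = o /\
    forall i, (S i < length p)%nat -> a (nth (S i) p 0%nat) (nth i p 0%nat).
Proof.
  revert x; induction k as [|k IH]; intros x Hx.
  - exists [x]; cbn in Hx; subst x; split; [repeat constructor; simpl; tauto|].
    split; [intros y [<-|[]]; reflexivity|].
    cbn; repeat split; lia.
  - destruct (classic (within a o k x)) as [H|H].
    + destruct (IH x H) as (p & Hn & Hw & Hp); exists p; split; [easy|].
      split; [intros y Hy; left; auto|easy].
    + destruct Hx as [Hx|(y & Hy & Hyx)]; [tauto|].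
      destruct (IH y Hy) as (p & Hn & Hw & Hl & H0 & Hlast & Hp).
      exists (x :: p); split; [constructor; auto|]; split; [|split; [|split; [|split]]].
      * intros w [<-|Hw']; [right; eauto|left; auto].
      * simpl; lia.
      * reflexivity.
      * destruct p as [|b p]; [simpl in Hl; lia|].
        cbn [length] in *; replace (S (S (length p)) - 1)%nat with (S (length p)) by lia.
        replace (S (length p) - 1)%nat with (length p) in Hlast by lia.
        exact Hlast.
      * intros [|i] Hi; cbn [nth length] in *; [now rewrite H0|apply Hp; lia].
Qed.

(** A simple [a]-path from [o] to [x], closed up by the edge between them, would be a cycle. *)
Lemma tree_edge_is_bridge nb r (a : nat -> nat -> Prop) o x k :
  is_tree nb r -> adj nb o x -> (forall u v, a u v -> adj nb u v) -> ~ a o x ->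
  ~ within a o k x.
Proof.
  intros (Hs & Hloop & _ & _ & Hcyc) Hox Ha Hnox Hw.
  destruct (within_simple_path _ _ _ _ Hw) as (p & Hn & _ & Hl & H0 & Hlast & Hp).
  apply (Hcyc p); split; [|split; [easy|split]].
  (* Fewer than three vertices would mean a loop at [o] or the step [a o x], both excluded. *)
  - destruct p as [|b [|c [|d p]]]; cbn [length nth] in *; try lia.
    + replace (1 - 1)%nat with 0%nat in Hlast by lia; simpl in Hlast; subst.
      exfalso; eapply Hloop; eauto.
    + replace (2 - 1)%nat with 1%nat in Hlast by lia; simpl in Hlast; subst.
      exfalso; apply Hnox, (Hp 0%nat); lia.
  - intros i Hi; apply Hs, Ha, Hp, Hi.
  - now rewrite Hlast, H0.
Qed.

(** A repetition with the smallest gap [d] closes a simple segment of the path: a loop for [d = 1],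
    a backtracking step for [d = 2], a cycle for [d >= 3]. *)
Lemma nb_path_injective nb r s i j :
  is_tree nb r -> nb_path nb r s -> s i = s j -> i = j.
Proof.
  intros (Hs & Hloop & _ & _ & Hcyc) (_ & Hadj & Hnb).
  assert (H : forall d, (0 < d)%nat -> forall m, s m <> s (m + d)%nat).
  { induction d as [d IH] using lt_wf_ind; intros Hd m E.
    assert (Hnth : forall b, (b < d)%nat -> nth b (map s (seq m d)) 0%nat = s (m + b)%nat).
    { intros b Hb; rewrite (nth_indep _ _ (s 0%nat)) by now rewrite length_map, length_seq.
      now rewrite map_nth, seq_nth. }
    apply (Hcyc (map s (seq m d))); split; [|split; [|split]];
      rewrite ?length_map, ?length_seq.
    - destruct d as [|[|[|d]]]; try lia.
      + exfalso; apply (Hloop (s m)); rewrite E at 2.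
        replace (m + 1)%nat with (S m) by lia; apply Hadj.
      + exfalso; apply (Hnb m); rewrite E; f_equal; lia.
    - apply (NoDup_nth _ 0%nat); intros b c; rewrite length_map, length_seq; intros Hb Hc.
      rewrite !Hnth by easy; intros Ebc.
      destruct (lt_eq_lt_dec b c) as [[Hlt|]|Hlt]; [exfalso|easy|exfalso].
      + apply (IH (c - b)%nat ltac:(lia) ltac:(lia) (m + b)%nat).
        rewrite Ebc; f_equal; lia.
      + apply (IH (b - c)%nat ltac:(lia) ltac:(lia) (m + c)%nat).
        rewrite <- Ebc; f_equal; lia.
    - intros b Hb; rewrite !Hnth by lia.
      replace (m + S b)%nat with (S (m + b)) by lia; apply Hadj.
    - rewrite !Hnth by lia.
      replace (s (m + 0)%nat) with (s (S (m + (d - 1))))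
        by (rewrite Nat.add_0_r, E; f_equal; lia).
      apply Hadj. }
  intros E; destruct (lt_eq_lt_dec i j) as [[Hlt|]|Hlt]; [exfalso|easy|exfalso].
  - apply (H (j - i)%nat ltac:(lia) i); rewrite E; f_equal; lia.
  - apply (H (i - j)%nat ltac:(lia) j); rewrite <- E; f_equal; lia.
Qed.

Lemma within_mono (a b : nat -> nat -> Prop) o k x :
  (forall u v, a u v -> b u v) -> within a o k x -> within b o k x.
Proof.
  intros H; revert x; induction k as [|k IH]; intros x; cbn [within]; [easy|].
  intros [Hx|(y & Hy & Hyx)]; [left; auto|right; exists y; auto].
Qed.

(** Otherwise, continuing from [s k] back down the spine would lead from [s i] to [s (S i)] without
    crossing the edge between them, which is a bridge. *)
Lemma spine_not_in_lower nb r s i k :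
  is_tree nb r -> nb_path nb r s -> (i < k)%nat -> ~ inA nb s i (s k).
Proof.
  intros Ht Hp Hik [m Hm]; pose proof Ht as (Hs & _); pose proof Hp as (_ & Hadj & _).
  set (a := fun u v => adj nb u v /\ ~ same_edge u v (s i) (s (S i))).
  assert (Hd : forall n, (n <= k - S i)%nat -> within a (s i) (m + n) (s (k - n)%nat)).
  { induction n as [|n IH]; intros Hn.
    - rewrite Nat.add_0_r, Nat.sub_0_r; revert Hm; apply within_mono.
      unfold adjA, a; tauto.
    - rewrite Nat.add_succ_r; right; exists (s (k - n)%nat); split; [apply IH; lia|].
      replace (k - n)%nat with (S (k - S n)) by lia; split; [apply Hs, Hadj|].
      intros [[E1 E2]|[E1 E2]];
        apply (nb_path_injective nb r s) in E1, E2; auto; lia. }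
  specialize (Hd (k - S i)%nat ltac:(lia)).
  replace (k - (k - S i))%nat with (S i) in Hd by lia.
  revert Hd; apply (tree_edge_is_bridge nb r); [easy|apply Hadj| |].
  - intros u v [H _]; exact H.
  - intros [_ H]; apply H; left; easy.
Qed.

(** The components [inA] are meant for indices from one on; the root is added as branch zero. *)
Definition on_branch (nb : nat -> list nat) (s : nat -> nat) (i v : nat) : Prop :=
  (i = 0%nat /\ v = s 0%nat) \/ ((1 <= i)%nat /\ inA nb s i v).

Definition spine_edge (s : nat -> nat) (v u : nat) : Prop :=
  exists k, same_edge v u (s k) (s (S k)).

Lemma spine_edge_sym s v u : spine_edge s v u -> spine_edge s u v.
Proof. intros [k H]; exists k; unfold same_edge in *; tauto. Qed.

Lemma on_branch_spine nb r s k i :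
  is_tree nb r -> nb_path nb r s -> on_branch nb s i (s k) -> (k <= i)%nat.
Proof.
  intros Ht Hp [[-> E]|[Hi H]].
  - apply (nb_path_injective nb r s) in E; auto; lia.
  - destruct (le_lt_dec k i); [easy|].
    exfalso; eapply spine_not_in_lower; eauto.
Qed.

Lemma spine_on_branch nb s k : on_branch nb s k (s k).
Proof. destruct k; [left; easy|right; split; [lia|exists 0%nat; reflexivity]]. Qed.

Lemma root_edge_spine nb r s u :
  length (nb r) = 1%nat -> nb_path nb r s -> In u (nb (s 0%nat)) -> u = s 1%nat.
Proof.
  intros Hr (<- & Hadj & _) Hu; specialize (Hadj 0%nat); unfold adj in Hadj.
  destruct (nb (s 0%nat)) as [|b [|c l]]; simpl in *; lia.
Qed.

(** Branches communicate only through spine edges; the sole edge at the root is one, which rules out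
    [i = 0]. *)
Lemma on_branch_adj nb r s i v u :
  length (nb r) = 1%nat -> nb_path nb r s -> adj nb v u -> ~ spine_edge s v u ->
  on_branch nb s i v ->
  (1 <= i)%nat /\ inA nb s i v /\ inA nb s i u /\ adjA nb s i v u.
Proof.
  intros Hr Hp Hvu Hsp [[-> ->]|[Hi [k Hk]]].
  - exfalso; apply Hsp; exists 0%nat; left; split; [easy|].
    eapply root_edge_spine; eauto.
  - assert (HA : adjA nb s i v u).
    { split; [easy|]; split; intros H; apply Hsp; [exists (i - 1)%nat|now exists i].
      now replace (S (i - 1)) with i by lia. }
    repeat split; auto; try apply HA; [now exists k|exists (S k); right; eauto].
Qed.

(* The profile [max (0, 1 - i/Rad)] on the i-th branch, written as an average
   of indicators. *)
Definition profile (nb : nat -> list nat) (s : nat -> nat) (Rad v : nat) : R :=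
  / INR Rad * rsum (fun j =>
    if excluded_middle_informative (exists i, (i <= j)%nat /\ on_branch nb s i v)
    then 1 else 0) (seq 0 Rad).

Lemma profile_bounds nb s Rad v : (0 < Rad)%nat -> 0 <= profile nb s Rad v <= 1.
Proof.
  intros H; apply lt_0_INR in H; unfold profile.
  set (F := fun j => _).
  assert (HF : forall j, 0 <= F j <= 1).
  { intros j; unfold F; destruct excluded_middle_informative; lra. }
  assert (H0 : 0 <= rsum F (seq 0 Rad)) by (apply rsum_nonneg; intros; apply HF).
  assert (H1 : rsum F (seq 0 Rad) <= INR Rad).
  { transitivity (rsum (fun _ => 1) (seq 0 Rad)); [apply rsum_le; intros; apply HF|].
    rewrite rsum_const, length_seq; lra. }
  assert (0 < / INR Rad) by now apply Rinv_0_lt_compat.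
  split; [nra|].
  apply (Rmult_le_reg_l (INR Rad)); [easy|]; rewrite <- Rmult_assoc, Rinv_r; lra.
Qed.

(** The vertex [s k] lies on branch [k] and on no lower one, so the indicator is one exactly for
    [k <= j]. Truncated subtraction supplies the maximum with zero. *)
Lemma profile_spine nb r s Rad k :
  is_tree nb r -> nb_path nb r s ->
  profile nb s Rad (s k) = / INR Rad * INR (Rad - k).
Proof.
  intros Ht Hp; unfold profile; f_equal.
  rewrite (rsum_ext _ (fun j => if le_dec k j then 1 else 0)).
  - induction Rad as [|n IH]; [reflexivity|].
    rewrite seq_S, rsum_app, IH; unfold rsum at 1; simpl fold_right.
    destruct (le_dec k n).
    + rewrite Nat.sub_succ_l, S_INR by easy; lra.
    + replace (n - k)%nat with 0%nat by lia; replace (S n - k)%nat with 0%nat by lia.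
      simpl; lra.
  - intros j _; destruct excluded_middle_informative as [(i & Hi & H)|H], (le_dec k j);
      try reflexivity.
    + apply (on_branch_spine nb r) in H; auto; lia.
    + exfalso; apply H; exists k; split; [easy|apply spine_on_branch].
Qed.

Lemma profile_support nb s Rad v :
  profile nb s Rad v <> 0 -> exists i, (i < Rad)%nat /\ on_branch nb s i v.
Proof.
  intros H; apply NNPP; intros Hn; apply H; unfold profile.
  rewrite (rsum_ext _ (fun _ => 0)); [rewrite rsum_const; lra|].
  intros j Hj; apply in_seq in Hj.
  destruct excluded_middle_informative as [(i & Hi & Hb)|]; [|easy].
  exfalso; apply Hn; exists i; split; [lia|easy].
Qed.

(** Both ends of a non-spine edge lie on the same branches; hence only spine edges enter the
    Dirichlet sum. *)
Lemma profile_adj nb r s Rad v u :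
  is_tree nb r -> length (nb r) = 1%nat -> nb_path nb r s -> adj nb v u ->
  ~ spine_edge s v u -> profile nb s Rad v = profile nb s Rad u.
Proof.
  intros (Hs & _) Hr Hp Hvu Hsp; unfold profile; f_equal; apply rsum_ext; intros j _.
  assert (Hb : forall i, on_branch nb s i v <-> on_branch nb s i u).
  { assert (H1 : forall i x y, adj nb x y -> ~ spine_edge s x y ->
      on_branch nb s i x -> on_branch nb s i y).
    { intros i x y Hxy Hn H.
      apply (on_branch_adj nb r s i x y) in H; auto; right; tauto. }
    intros i; split; apply H1; auto.
    intros H; now apply Hsp, spine_edge_sym. }
  destruct excluded_middle_informative as [(i & Hi & H)|H],
    excluded_middle_informative as [(i' & Hi' & H')|H']; try reflexivity; exfalso.
  - apply H'; exists i; now rewrite <- Hb.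
  - apply H; exists i'; now rewrite Hb.
Qed.

Lemma profile_hull_edge nb r s Rad v u :
  is_tree nb r -> length (nb r) = 1%nat -> nb_path nb r s -> adj nb v u ->
  profile nb s Rad v <> 0 -> hull_edge nb s Rad v u.
Proof.
  intros Ht Hr Hp Hvu Hv; destruct (classic (spine_edge s v u)) as [[k Hk]|Hsp].
  - left; exists k; split; [|easy].
    (* The profile vanishes on the spine from [s Rad] on, so [v] cannot be an end of a later spine
       edge. *)
    destruct (lt_dec k Rad) as [|Hlt]; [easy|exfalso; apply Hv].
    destruct Hk as [[-> _]|[-> _]]; rewrite (profile_spine nb r) by easy;
      [replace (Rad - k)%nat with 0%nat by lia|replace (Rad - S k)%nat with 0%nat by lia];
      simpl; lra.
  - right; destruct (profile_support _ _ _ _ Hv) as (i & Hi & Hb); exists i.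
    apply (on_branch_adj nb r s i v u) in Hb; auto; repeat split; try tauto; try lia;
      apply Hb.
Qed.

Lemma hull_edge_sym nb s Rad v u :
  (forall x y, adj nb x y -> adj nb y x) ->
  hull_edge nb s Rad v u -> hull_edge nb s Rad u v.
Proof.
  intros Hs [(i & Hi & H)|(i & Hi & Hv & Hu & H1 & H2)]; [left|right]; exists i;
    unfold same_edge in *; [tauto|].
  unfold adjA, same_edge; repeat split; auto; tauto.
Qed.

(** * Energy of the test function *)

Definition flip (e : nat * nat) : nat * nat := (snd e, fst e).

(** [hull_edges] lists each edge once, smaller end first, whereas [edge_sum] sees both orientations;
    appending the flipped list reconciles them and causes the factor 2 in [profile_mass]. *)
Lemma hull_edges_both nb r s Rad E v u :
  is_tree nb r -> hull_edges nb s Rad E -> adj nb v u -> hull_edge nb s Rad v u ->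
  In (v, u) (E ++ map flip E).
Proof.
  intros (Hs & Hloop & _) [_ HE] Hvu H; apply in_app_iff.
  destruct (lt_eq_lt_dec v u) as [[Hlt| ->]|Hlt].
  - left; now apply HE.
  - exfalso; eapply Hloop; eauto.
  - right; apply in_map_iff; exists (u, v); split; [easy|]; apply HE; split; [easy|].
    now apply hull_edge_sym.
Qed.

Lemma profile_mass nb r s Rad E V :
  is_tree nb r -> length (nb r) = 1%nat -> nb_path nb r s -> (0 < Rad)%nat ->
  hull_edges nb s Rad E -> NoDup V ->
  edge_sum nb V (fun v _ => profile nb s Rad v * profile nb s Rad v) <= 2 * INR (length E).
Proof.
  intros Ht Hr Hp HR HE HV; pose proof Ht as (_ & _ & Hnd & _).
  rewrite edge_sum_list.
  transitivity (rsum (fun e => profile nb s Rad (fst e) * profile nb s Rad (fst e))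
    (E ++ map flip E)).
  - apply rsum_incl_le; [now apply NoDup_edge_list|intros; apply Rle_0_sqr|].
    intros [v u] Hvu H; apply in_edge_list in Hvu; cbn [fst] in H.
    apply (hull_edges_both nb r s Rad); auto; [apply Hvu|].
    apply (profile_hull_edge nb r); auto; [apply Hvu|].
    intros E0; apply H; rewrite E0; lra.
  - transitivity (rsum (fun _ => 1) (E ++ map flip E)).
    + apply rsum_le; intros [v u] _; cbn [fst].
      pose proof (profile_bounds nb s Rad v HR); nra.
    + rewrite rsum_const, length_app, length_map, plus_INR; lra.
Qed.

Lemma profile_spine_step nb r s Rad k :
  is_tree nb r -> nb_path nb r s -> (k < Rad)%nat ->
  profile nb s Rad (s k) - profile nb s Rad (s (S k)) = / INR Rad.
Proof.
  intros Ht Hp Hk; rewrite !(profile_spine nb r) by easy.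
  replace (Rad - k)%nat with (S (Rad - S k)) by lia; rewrite S_INR; lra.
Qed.

(** At most the [2 * Rad] oriented spine edges between [s 0] and [s Rad] contribute, each the square
    of [/ INR Rad]. *)
Lemma profile_dirichlet nb r s Rad V :
  is_tree nb r -> length (nb r) = 1%nat -> nb_path nb r s -> (0 < Rad)%nat -> NoDup V ->
  edge_sum nb V (fun v u => (profile nb s Rad v - profile nb s Rad u) *
    (profile nb s Rad v - profile nb s Rad u)) <= 2 / INR Rad.
Proof.
  intros Ht Hr Hp HR HV; pose proof Ht as (_ & _ & Hnd & _).
  rewrite edge_sum_list; set (f := profile nb s Rad).
  set (L := map (fun k => (s k, s (S k))) (seq 0 Rad)).
  set (F := fun e => (f (fst e) - f (snd e)) * (f (fst e) - f (snd e))).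
  change (rsum F (edge_list nb V) <= 2 / INR Rad).
  transitivity (rsum F (L ++ map flip L)).
  - apply rsum_incl_le; [now apply NoDup_edge_list|intros; apply Rle_0_sqr|].
    intros [v u] Hvu H; apply in_edge_list in Hvu; unfold F in H; cbn [fst snd] in H.
    destruct (classic (spine_edge s v u)) as [[k Hk]|Hsp].
    + assert (HkR : (k < Rad)%nat).
      { destruct (lt_dec k Rad) as [|Hlt]; [easy|exfalso; apply H].
        assert (H0 : f (s k) = 0 /\ f (s (S k)) = 0).
        { unfold f; rewrite !(profile_spine nb r) by easy.
          replace (Rad - k)%nat with 0%nat by lia.
          replace (Rad - S k)%nat with 0%nat by lia.
          simpl; lra. }
        destruct H0 as [H0 H1], Hk as [[-> ->]|[-> ->]]; rewrite H0, H1; lra. }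
      assert (HL : In (s k, s (S k)) L).
      { apply in_map_iff; exists k; split; [easy|]; apply in_seq; lia. }
      apply in_app_iff; destruct Hk as [[-> ->]|[-> ->]]; [now left|right].
      apply in_map_iff; now exists (s k, s (S k)).
    + exfalso; apply H; unfold f; rewrite (profile_adj nb r s Rad v u); auto; try lra.
      apply Hvu.
  - assert (HF : rsum F L = / INR Rad).
    { unfold L; rewrite rsum_map.
      rewrite (rsum_ext _ (fun _ => / INR Rad * / INR Rad)).
      - rewrite rsum_const, length_seq; field; apply not_0_INR; lia.
      - intros k Hk; apply in_seq in Hk; unfold F, f; cbn [fst snd].
        rewrite (profile_spine_step nb r) by (easy || lia); reflexivity. }
    rewrite rsum_app, rsum_map, HF.
    rewrite (rsum_ext _ F); [rewrite HF; lra|].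
    intros [v u] _; unfold F; cbn [flip fst snd]; ring.
Qed.

Lemma profile_energy nb r s Rad E z V :
  is_tree nb r -> length (nb r) = 1%nat -> nb_path nb r s -> (0 < Rad)%nat ->
  hull_edges nb s Rad E -> 0 < z < 1 -> NoDup V ->
  bform nb V z (profile nb s Rad) (profile nb s Rad) <=
    z / INR Rad + (1 - z) * (2 * INR (length E)).
Proof.
  intros Ht Hr Hp HR HE Hz HV; unfold bform.
  rewrite edge_sum_plus, !edge_sum_scal.
  apply Rplus_le_compat.
  - replace (z / INR Rad) with (z / 2 * (2 / INR Rad))
      by (field; apply not_0_INR; lia).
    apply Rmult_le_compat_l; [lra|]; now apply (profile_dirichlet nb r).
  - apply Rmult_le_compat_l; [lra|]; now apply (profile_mass nb r).
Qed.

Lemma profile_finite_support nb r s Rad E :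
  is_tree nb r -> length (nb r) = 1%nat -> nb_path nb r s -> hull_edges nb s Rad E ->
  exists K, forall v, profile nb s Rad v <> 0 -> within (adj nb) r K v.
Proof.
  intros Ht Hr Hp HE; pose proof Ht as (_ & _ & _ & Hc & _).
  assert (HK : forall l : list (nat * nat),
    exists K, forall e, In e l -> within (adj nb) r K (fst e)).
  { induction l as [|e l [K IH]]; [now exists 0%nat|].
    destruct (Hc (fst e)) as [k Hk]; exists (Nat.max k K).
    intros e' [<-|He']; [apply (within_le _ _ k)|apply (within_le _ _ K)]; auto; lia. }
  destruct (HK (E ++ map flip E)) as [K H]; exists K; intros v Hv.
  (* Having a neighbour, [v] is an end of a hull edge, so the finite list of these edges bounds its
     depth. *)
  pose proof (degree_pos nb r v Ht Hr) as Hd.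
  destruct (nb v) as [|u l] eqn:Eu; [simpl in Hd; lia|].
  assert (Hvu : adj nb v u) by (unfold adj; rewrite Eu; now left).
  apply (H (v, u)); apply (hull_edges_both nb r s Rad); auto.
  now apply (profile_hull_edge nb r).
Qed.

Lemma green_hull_lower nb r s z Rad E T lam :
  is_tree nb r -> length (nb r) = 1%nat -> nb_path nb r s -> (0 < Rad)%nat ->
  hull_edges nb s Rad E -> 0 < z < 1 -> 0 <= lam ->
  2 * lam * (1 - z ^ S T) <= green nb r z T r +
    lam * lam * (z / INR Rad + (1 - z) * (2 * INR (length E))).
Proof.
  intros Ht Hr Hp HR HE Hz Hlam.
  apply green_lower with (f := profile nb s Rad); auto.
  - now apply (profile_finite_support nb r s Rad E).
  - intros v; now apply profile_bounds.
  - pose proof Hp as (H0 & _); rewrite <- H0 at 1; rewrite (profile_spine nb r) by easy.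
    rewrite Nat.sub_0_r; apply Rinv_l, not_0_INR; lia.
  - intros V HV; now apply (profile_energy nb r).
Qed.

(** * Asymptotics *)

Lemma Q_is_green nb r x q :
  0 < x < 1 -> Q_is nb r x q -> Un_cv (fun T => green nb r (sqrt (1 - x)) T r) q.
Proof.
  intros Hx Hq eps He; destruct (Hq eps He) as [N HN]; exists N; intros n Hn.
  specialize (HN n Hn); unfold green.
  rewrite (sum_eq _ (fun t => return_prob nb r t * Rpower (1 - x) (INR t / 2)));
    [exact HN|].
  intros i _; unfold return_prob; rewrite Rmult_comm; f_equal.
  rewrite <- Rpower_sqrt by lra; rewrite <- Rpower_pow by apply exp_pos.
  rewrite Rpower_mult; f_equal; field.
Qed.

(** This trades the killing rate [1 - z] for [x] in both bounds on [Q]; the threshold [3 / 4] is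
    where the root equals [1 / 2]. *)
Lemma sqrt_bounds x : 0 < x < 3 / 4 ->
  1 / 2 <= sqrt (1 - x) < 1 /\ x / 2 <= 1 - sqrt (1 - x) <= x.
Proof.
  intros Hx; pose proof (sqrt_def (1 - x) ltac:(lra)) as H.
  pose proof (sqrt_pos (1 - x)); nra.
Qed.

Lemma Q_upper nb r x q Rad E :
  is_tree nb r -> length (nb r) = 1%nat -> 0 < x < 3 / 4 -> Q_is nb r x q ->
  ball_edges nb r Rad E -> (0 < length E)%nat ->
  q <= 4 * INR Rad + 4 / (x * INR (length E)).
Proof.
  intros Ht Hr Hx Hq HE HE0; apply Q_is_green in Hq; [|lra].
  destruct (sqrt_bounds x Hx) as [Hz1 Hz2]; set (z := sqrt (1 - x)) in *.
  assert (Hn : 0 < INR (length E)) by now apply lt_0_INR.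
  pose proof (pos_INR Rad) as HR.
  apply (@Rle_cv_lim (fun T => green nb r z T r)
    (fun _ => 4 * INR Rad + 4 / (x * INR (length E)))); [|exact Hq|].
  - intros T.
    apply (Rle_trans _ _ _ (green_upper nb r z T Rad E Ht Hr ltac:(lra) HE HE0)).
    apply Rplus_le_compat.
    + apply (Rmult_le_reg_r z); [lra|]; unfold Rdiv.
      rewrite Rmult_assoc, Rinv_l by lra; nra.
    + replace (4 / (x * INR (length E))) with (2 / (x / 2 * INR (length E)))
        by (field; lra).
      apply Rmult_le_compat_l; [lra|]; apply Rinv_le_contravar; nra.
  - intros eps He; exists 0%nat; intros; now rewrite Rdist_eq.
Qed.

Lemma Q_lower nb r s x q Rad E :
  is_tree nb r -> length (nb r) = 1%nat -> nb_path nb r s -> 0 < x < 3 / 4 ->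
  Q_is nb r x q -> (0 < Rad)%nat -> hull_edges nb s Rad E ->
  1 <= q * (/ INR Rad + 2 * (x * INR (length E))).
Proof.
  intros Ht Hr Hp Hx Hq HR HE; apply Q_is_green in Hq; [|lra].
  destruct (sqrt_bounds x Hx) as [Hz1 Hz2]; set (z := sqrt (1 - x)) in *.
  set (c := z / INR Rad + (1 - z) * (2 * INR (length E))).
  assert (Hg : forall T, green nb r z T r <= q).
  { intros T; apply (sum_incr (fun t => z ^ t * hit nb r t r) T q); [exact Hq|].
    intros t; apply Rmult_le_pos; [apply pow_le; lra|apply hit_nonneg]. }
  assert (Hq1 : 1 <= q).
  { rewrite <- (Hg 0%nat); unfold green; cbn [sum_f_R0 hit pow].
    rewrite Nat.eqb_refl; lra. }
  (* The limit of [green_hull_lower] as [T] grows, with the multiplier [q]; cancelling [q] leaves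
     [1 <= q * c]. *)
  assert (Hc : 2 * q <= q + q * q * c).
  { apply Rnot_lt_le; intros Hlt.
    set (e := 2 * q - (q + q * q * c)).
    (* Makes the truncation loss [2 * q * z ^ S N] smaller than the supposed gap [e]. *)
    destruct (pow_lt_1_zero z ltac:(rewrite Rabs_pos_eq; lra) (e / (2 * q)))
      as [N HN]; [apply Rdiv_lt_0_compat; unfold e; lra|].
    specialize (HN (S N) ltac:(lia)); rewrite Rabs_pos_eq in HN by (apply pow_le; lra).
    pose proof (green_hull_lower nb r s z Rad E N q Ht Hr Hp HR HE ltac:(lra) ltac:(lra))
      as H; fold c in H; specialize (Hg N).
    apply (Rmult_lt_compat_l (2 * q)) in HN; [|lra].
    replace (2 * q * (e / (2 * q))) with e in HN by (field; lra).
    unfold e in HN; lra. }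
  assert (Hc1 : 1 <= q * c) by (apply (Rmult_le_reg_l q); lra).
  rewrite Hc1; apply Rmult_le_compat_l; [lra|]; unfold c.
  apply Rplus_le_compat.
  - unfold Rdiv; pose proof (Rinv_0_lt_compat _ (lt_0_INR _ HR)); nra.
  - pose proof (pos_INR (length E)); nra.
Qed.

(** * Growth along geometric sequences *)

Lemma pow_large b M : 1 < b -> exists N, forall n, (N <= n)%nat -> M < b ^ n.
Proof.
  intros Hb; destruct (Pow_x_infinity b ltac:(rewrite Rabs_pos_eq; lra) (M + 1)) as [N H].
  exists N; intros n Hn; specialize (H n Hn).
  rewrite Rabs_pos_eq in H by (apply pow_le; lra); lra.
Qed.

Lemma exp_mult_nat a n : exp a ^ n = exp (INR n * a).
Proof.
  induction n as [|n IH]; [now rewrite Rmult_0_l, exp_0|].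
  cbn [pow]; rewrite IH, <- exp_plus, S_INR; f_equal; ring.
Qed.

Lemma exp_le x y : x <= y -> exp x <= exp y.
Proof. intros [H| ->]; [left; now apply exp_increasing|lra]. Qed.

(* Iterates the ratio condition at [lam = b]; uniformity in [lam] (Potter's
   bounds) is only needed away from geometric sequences. *)
Lemma slowly_varying_geometric L b delta :
  slowly_varying_infty L -> 1 < b -> 0 < delta ->
  exists N, forall n, (N <= n)%nat ->
    exp (- delta * INR n) <= L (b ^ n) <= exp (delta * INR n).
Proof.
  (* Half of [delta] pays for the successive ratios, the other half absorbs the initial constant
     [C]. *)
  intros (Hpos & _ & HL) Hb Hd; set (e := delta / 2).
  assert (He : 0 < 1 - exp (- e)).
  { enough (exp (- e) < exp 0) by (rewrite exp_0 in *; lra).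
    apply exp_increasing; unfold e; lra. }
  (* One tolerance serves both sides, because [exp e + exp (- e) >= 2]. *)
  assert (He2 : 1 - exp (- e) <= exp e - 1).
  { pose proof (exp_pos e); rewrite exp_Ropp.
    apply (Rmult_le_reg_l (exp e)); [easy|].
    rewrite Rmult_minus_distr_l, Rinv_r by lra.
    pose proof (Rle_0_sqr (exp e - 1)) as Hs; unfold Rsqr in Hs; lra. }
  destruct (HL b ltac:(lra) _ He) as [M HM].
  destruct (pow_large b M Hb) as [N0 HN0].
  assert (HLp : forall n, 0 < L (b ^ n)) by (intros n; apply Hpos, pow_lt; lra).
  assert (Hstep : forall n, (N0 <= n)%nat ->
    exp (- e) * L (b ^ n) <= L (b ^ S n) <= exp e * L (b ^ n)).
  { intros n Hn; specialize (HM _ (HN0 n Hn)); specialize (HLp n).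
    apply Rabs_def2 in HM; cbn [pow]; set (y := L (b ^ n)) in *.
    set (w := L (b * b ^ n)) in *.
    assert (Hw : w = w / y * y) by (field; lra).
    rewrite Hw; split; apply Rmult_le_compat_r; lra. }
  set (C := ln (L (b ^ N0))).
  assert (Hm : forall m, exp (C - e * INR m) <= L (b ^ (N0 + m)) <= exp (C + e * INR m)).
  { induction m as [|m IH].
    - simpl INR; rewrite Rmult_0_r, Rminus_0_r, Rplus_0_r, Nat.add_0_r.
      unfold C; rewrite exp_ln by apply HLp; lra.
    - rewrite Nat.add_succ_r; destruct (Hstep (N0 + m)%nat ltac:(lia)) as [H1 H2].
      rewrite S_INR; split.
      + rewrite <- H1.
        replace (C - e * (INR m + 1)) with (- e + (C - e * INR m)) by ring.
        rewrite exp_plus; apply Rmult_le_compat_l; [left; apply exp_pos|easy].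
      + rewrite H2.
        replace (C + e * (INR m + 1)) with (e + (C + e * INR m)) by ring.
        rewrite exp_plus; apply Rmult_le_compat_l; [left; apply exp_pos|easy]. }
  destruct (INR_unbounded (Rabs C / e)) as [N1 HN1].
  exists (Nat.max N0 N1); intros n Hn.
  specialize (Hm (n - N0)%nat); replace (N0 + (n - N0))%nat with n in Hm by lia.
  rewrite minus_INR in Hm by lia.
  assert (HC : Rabs C <= e * INR n).
  { assert (INR N1 <= INR n) by (apply le_INR; lia).
    apply (Rmult_le_reg_r (/ e)); [apply Rinv_0_lt_compat; unfold e; lra|].
    replace (e * INR n * / e) with (INR n) by (field; unfold e; lra).
    unfold Rdiv in HN1; lra. }
  pose proof (Rle_abs C); pose proof (Rle_abs (- C)) as HC'; rewrite Rabs_Ropp in HC'.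
  assert (0 <= e * INR N0) by (apply Rmult_le_pos; [unfold e; lra|apply pos_INR]).
  assert (delta = 2 * e) by (unfold e; lra).
  split; [rewrite <- (proj1 Hm)|rewrite (proj2 Hm)]; apply exp_le; nra.
Qed.

(** Divide by [INR n], let [n] grow, then let [delta] vanish. This turns bounds between exponentials
    into inequalities between exponents. *)
Lemma linear_growth_le a b C :
  (forall delta, 0 < delta -> exists N, forall n, (N <= n)%nat ->
    INR n * a <= C + INR n * b + delta * INR n) -> a <= b.
Proof.
  intros H; apply Rnot_lt_le; intros Hlt.
  destruct (H ((a - b) / 2) ltac:(lra)) as [N HN].
  destruct (INR_unbounded (2 * C / (a - b))) as [N1 HN1].
  specialize (HN (Nat.max N N1) ltac:(lia)).
  assert (H1 : 2 * C / (a - b) < INR (Nat.max N N1)).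
  { apply (Rlt_le_trans _ _ _ HN1), le_INR; lia. }
  apply (Rmult_lt_compat_r (a - b)) in H1; [|lra].
  replace (2 * C / (a - b) * (a - b)) with (2 * C) in H1 by (field; lra).
  lra.
Qed.

Lemma Rpower_two_pow n d : Rpower (2 ^ n) d = exp (INR n * (d * ln 2)).
Proof.
  unfold Rpower; f_equal; rewrite <- Rpower_pow by lra; rewrite ln_Rpower; ring.
Qed.

(** Along radii [2 ^ n] the slowly varying factors cost at most [delta * INR n] in the exponent.
    Abstracting [edges] serves balls and hulls alike. *)
Lemma growth_geometric (edges : nat -> list (nat * nat) -> Prop) R0 Ll Lu d delta :
  slowly_varying_infty Ll -> slowly_varying_infty Lu ->
  (forall Rad : nat, R0 < INR Rad -> exists E, edges Rad E /\
      Rpower (INR Rad) d * Ll (INR Rad) < INR (length E) /\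
      INR (length E) < Rpower (INR Rad) d * Lu (INR Rad)) ->
  0 < delta -> exists N, forall n, (N <= n)%nat -> exists E, edges (2 ^ n)%nat E /\
    exp (INR n * (d * ln 2) - delta * INR n) < INR (length E) <
    exp (INR n * (d * ln 2) + delta * INR n).
Proof.
  intros Hl Hu H Hd.
  destruct (slowly_varying_geometric Ll 2 delta Hl ltac:(lra) Hd) as [N1 H1].
  destruct (slowly_varying_geometric Lu 2 delta Hu ltac:(lra) Hd) as [N2 H2].
  destruct (pow_large 2 R0 ltac:(lra)) as [N3 H3].
  exists (Nat.max N1 (Nat.max N2 N3)); intros n Hn.
  specialize (H1 n ltac:(lia)); specialize (H2 n ltac:(lia)); specialize (H3 n ltac:(lia)).
  assert (E2 : INR (2 ^ n) = 2 ^ n) by (rewrite pow_INR; reflexivity).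
  destruct (H (2 ^ n)%nat) as (E & HE & Hlow & Hup); [now rewrite E2|].
  rewrite E2, Rpower_two_pow in Hlow, Hup.
  exists E; split; [easy|]; unfold Rminus; rewrite !exp_plus.
  pose proof (exp_pos (INR n * (d * ln 2))).
  replace (- (delta * INR n)) with (- delta * INR n) by ring.
  split; nra.
Qed.

(** A nonempty list has at least one entry, so the upper bound cannot decay exponentially. This
    makes the denominators [1 + dh] and [1 + dhb] positive. *)
Lemma growth_exponent_nonneg (edges : nat -> list (nat * nat) -> Prop) R0 Ll Lu d :
  slowly_varying_infty Ll -> slowly_varying_infty Lu ->
  (forall Rad : nat, R0 < INR Rad -> exists E, edges Rad E /\
      Rpower (INR Rad) d * Ll (INR Rad) < INR (length E) /\
      INR (length E) < Rpower (INR Rad) d * Lu (INR Rad)) -> 0 <= d.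
Proof.
  intros Hl Hu H; pose proof ln_lt_2.
  enough (0 <= d * ln 2) by nra.
  apply (linear_growth_le _ _ 0); intros delta Hd.
  destruct (growth_geometric edges R0 Ll Lu d delta Hl Hu H Hd) as [N HN].
  exists N; intros n Hn; destruct (HN n Hn) as (E & _ & H1 & H2).
  assert (HE : (1 <= length E)%nat).
  { apply INR_lt; simpl INR; pose proof (exp_pos (INR n * (d * ln 2) - delta * INR n)); lra. }
  apply le_INR in HE; simpl INR in HE.
  apply Rnot_lt_le; intros Hlt.
  enough (exp (INR n * (d * ln 2) + delta * INR n) < exp 0) by (rewrite exp_0 in *; lra).
  apply exp_increasing; lra.
Qed.

(** The substitution [x = exp (- (INR n * a))] turns slow variation at zero into slow variation
    along the powers of [exp a]. *)
Lemma spectral_geometric nb r ds a delta :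
  spectral_dim nb r ds -> 0 < a -> 0 < delta ->
  exists N, forall n, (N <= n)%nat -> exists x q, x = exp (- (INR n * a)) /\
    0 < x < 3 / 4 /\ Q_is nb r x q /\
    exp (INR n * (a * (1 - ds / 2)) - delta * INR n) < q <
    exp (INR n * (a * (1 - ds / 2)) + delta * INR n).
Proof.
  intros (x0 & ll & lu & Hx0 & Hl & Hu & H) Ha Hd.
  assert (Hb : 1 < exp a) by (rewrite <- exp_0; now apply exp_increasing).
  destruct (slowly_varying_geometric _ (exp a) delta Hl Hb Hd) as [N1 H1].
  destruct (slowly_varying_geometric _ (exp a) delta Hu Hb Hd) as [N2 H2].
  destruct (pow_large (exp a) (/ Rmin x0 (3 / 4)) Hb) as [N3 H3].
  exists (Nat.max N1 (Nat.max N2 N3)); intros n Hn.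
  specialize (H1 n ltac:(lia)); specialize (H2 n ltac:(lia)); specialize (H3 n ltac:(lia)).
  cbv beta in H1, H2; rewrite exp_mult_nat, <- exp_Ropp in H1, H2.
  rewrite exp_mult_nat in H3; set (x := exp (- (INR n * a))) in *.
  assert (Hx : 0 < x < Rmin x0 (3 / 4)).
  { split; [apply exp_pos|]; unfold x; rewrite exp_Ropp.
    assert (0 < Rmin x0 (3 / 4)) by (apply Rmin_pos; lra).
    rewrite <- (Rinv_inv (Rmin x0 (3 / 4))); apply Rinv_lt_contravar; [|easy].
    apply Rmult_lt_0_compat; [now apply Rinv_0_lt_compat|apply exp_pos]. }
  pose proof (Rmin_l x0 (3 / 4)); pose proof (Rmin_r x0 (3 / 4)).
  destruct (H x ltac:(lra)) as (q & Hq & Hlow & Hup).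
  exists x, q; split; [easy|]; split; [lra|]; split; [easy|].
  replace (Rpower x (-1 + ds / 2)) with (exp (INR n * (a * (1 - ds / 2)))) in Hlow, Hup.
  2: { unfold Rpower, x; rewrite ln_exp; f_equal; field. }
  set (A := INR n * (a * (1 - ds / 2))) in *; pose proof (exp_pos A).
  replace (A - delta * INR n) with (A + - delta * INR n) by ring.
  rewrite !exp_plus.
  split; nra.
Qed.

(** * The two inequalities *)

Lemma hausdorff_lower_bound nb r dh ds :
  is_tree nb r -> length (nb r) = 1%nat ->
  hausdorff_dim nb r dh -> spectral_dim nb r ds -> 2 * dh / (1 + dh) <= ds.
Proof.
  intros Ht Hr (R0 & Ll & Lu & HR0 & Hl & Hu & H) Hs.
  pose proof (growth_exponent_nonneg _ _ _ _ _ Hl Hu H) as Hd.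
  (* For [R = 2 ^ n] the point [exp (- (INR n * a))] is [R^-(1+dh)], where the terms [R] and
     [1 / (x |B_R|)] of [Q_upper] have the same order up to slowly varying factors. *)
  pose proof ln_lt_2 as Hln; set (a := (1 + dh) * ln 2).
  assert (Ha : 0 < a) by (apply Rmult_lt_0_compat; lra).
  assert (Hle : a * (1 - ds / 2) <= ln 2).
  (* The 8 adds up the two factors 4 of [Q_upper]; the spectral and the volume asymptotics use half
     of [delta] each. *)
  { apply (linear_growth_le _ _ (ln 8)); intros delta Hdelta.
    set (e := delta / 2); assert (He : 0 < e) by (unfold e; lra).
    destruct (spectral_geometric nb r ds a e Hs Ha He) as [N1 H1].
    destruct (growth_geometric _ _ _ _ _ e Hl Hu H He) as [N2 H2].
    exists (Nat.max N1 N2); intros n Hn.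
    destruct (H1 n ltac:(lia)) as (x & q & Ex & Hx & Hq & Hlow & _).
    destruct (H2 n ltac:(lia)) as (E & HE & HEl & _).
    assert (HE0 : (0 < length E)%nat).
    { apply INR_lt; simpl INR; eapply Rlt_trans; [apply exp_pos|exact HEl]. }
    pose proof (Q_upper nb r x q (2 ^ n) E Ht Hr Hx Hq HE HE0) as HQ.
    assert (Hn0 : 0 <= e * INR n) by (apply Rmult_le_pos; [lra|apply pos_INR]).
    assert (HR : INR (2 ^ n) <= exp (INR n * ln 2 + e * INR n)).
    { rewrite pow_INR; change (INR 2) with 2.
      rewrite <- (exp_ln 2) at 1 by lra; rewrite exp_mult_nat; apply exp_le; lra. }
    assert (HxE : / (x * INR (length E)) <= exp (INR n * ln 2 + e * INR n)).
    { rewrite <- (Rinv_inv (exp _)); apply Rinv_le_contravar;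
        [apply Rinv_0_lt_compat, exp_pos|].
      rewrite <- exp_Ropp.
      transitivity (x * exp (INR n * (dh * ln 2) - e * INR n));
        [|apply Rmult_le_compat_l; lra].
      rewrite Ex, <- exp_plus; apply exp_le; unfold a; lra. }
    assert (Hlog : exp (INR n * (a * (1 - ds / 2)) - e * INR n) <=
      exp (ln 8 + (INR n * ln 2 + e * INR n))).
    { rewrite (exp_plus (ln 8)), exp_ln by lra; rewrite Rdiv_def in HQ; lra. }
    apply Rnot_lt_le; intros Hlt.
    apply (Rle_not_lt _ _ Hlog), exp_increasing; unfold e in *; lra. }
  assert (Hle' : (1 + dh) * (1 - ds / 2) <= 1).
  { apply (Rmult_le_reg_r (ln 2)); [lra|]; unfold a in Hle; lra. }
  apply (Rmult_le_reg_r (1 + dh)); [lra|]; unfold Rdiv.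
  rewrite Rmult_assoc, Rinv_l by lra; lra.
Qed.

(** At the scale [x = R^-(1+dhb)] both terms of [Q_lower] are of order [1 / R] up to slowly varying
    factors, so [Q] grows at least with exponent one in [R]; comparison with [ds] gives
    [1 <= (1 + dhb) * (1 - ds / 2)]. *)
Lemma hull_upper_bound nb r s dhb ds :
  is_tree nb r -> length (nb r) = 1%nat -> nb_path nb r s ->
  hull_dim nb s dhb -> spectral_dim nb r ds -> ds <= 2 * dhb / (1 + dhb).
Proof.
  intros Ht Hr Hp (R0 & Ll & Lu & HR0 & Hl & Hu & H) Hs.
  pose proof (growth_exponent_nonneg _ _ _ _ _ Hl Hu H) as Hd.
  pose proof ln_lt_2 as Hln; set (a := (1 + dhb) * ln 2).
  assert (Ha : 0 < a) by (apply Rmult_lt_0_compat; lra).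
  assert (Hle : ln 2 <= a * (1 - ds / 2)).
  (* The 3 adds up the coefficients 1 and 2 of the two terms in [Q_lower]. *)
  { apply (linear_growth_le _ _ (ln 3)); intros delta Hdelta.
    set (e := delta / 2); assert (He : 0 < e) by (unfold e; lra).
    destruct (spectral_geometric nb r ds a e Hs Ha He) as [N1 H1].
    destruct (growth_geometric _ _ _ _ _ e Hl Hu H He) as [N2 H2].
    exists (Nat.max N1 N2); intros n Hn.
    destruct (H1 n ltac:(lia)) as (x & q & Ex & Hx & Hq & _ & Hup).
    destruct (H2 n ltac:(lia)) as (E & HE & _ & HEu).
    pose proof (Q_lower nb r s x q (2 ^ n) E Ht Hr Hp Hx Hq
      ltac:(apply Nat.neq_0_lt_0, Nat.pow_nonzero; lia) HE) as HQ.
    assert (Hn0 : 0 <= e * INR n) by (apply Rmult_le_pos; [lra|apply pos_INR]).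
    set (y := exp (- (INR n * ln 2) + e * INR n)).
    assert (HR : / INR (2 ^ n) <= y).
    { rewrite pow_INR; change (INR 2) with 2.
      rewrite <- (exp_ln 2) at 1 by lra; rewrite exp_mult_nat, <- exp_Ropp.
      apply exp_le; lra. }
    assert (HxE : x * INR (length E) <= y).
    { transitivity (x * exp (INR n * (dhb * ln 2) + e * INR n));
        [apply Rmult_le_compat_l; lra|].
      rewrite Ex, <- exp_plus; apply exp_le; unfold a; lra. }
    assert (Hy : 0 < y) by apply exp_pos.
    assert (Hxe : 0 <= x * INR (length E))
      by (apply Rmult_le_pos; [lra|apply pos_INR]).
    set (w := exp (INR n * (a * (1 - ds / 2)) + e * INR n)) in *.
    assert (Hw : 0 < w) by apply exp_pos.
    assert (HRp : 0 < / INR (2 ^ n)).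
    { apply Rinv_0_lt_compat, lt_0_INR, Nat.neq_0_lt_0, Nat.pow_nonzero; lia. }
    assert (H1w : 1 <= w * (3 * y)).
    { rewrite HQ; transitivity (w * (/ INR (2 ^ n) + 2 * (x * INR (length E)))).
      - apply Rmult_le_compat_r; lra.
      - apply Rmult_le_compat_l; lra. }
    apply Rnot_lt_le; intros Hlt; apply (Rle_not_lt _ _ H1w).
    apply (Rlt_le_trans _ (exp 0)); [|rewrite exp_0; lra].
    rewrite <- (exp_ln 3) by lra; unfold w, y; rewrite <- !exp_plus.
    apply exp_increasing; unfold e in *; lra. }
  assert (Hle' : 1 <= (1 + dhb) * (1 - ds / 2)).
  { apply (Rmult_le_reg_r (ln 2)); [lra|]; unfold a in Hle; lra. }
  apply (Rmult_le_reg_r (1 + dhb)); [lra|]; unfold Rdiv.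
  rewrite (Rmult_assoc (2 * dhb)), Rinv_l by lra; lra.
Qed.

Theorem theorem1 (nb : nat -> list nat) (r : nat) (s : nat -> nat) (dh dhb ds : R) :
  in_GammaS nb r -> nb_path nb r s ->
  hausdorff_dim nb r dh -> hull_dim nb s dhb -> spectral_dim nb r ds ->
  2 * dh / (1 + dh) <= ds <= 2 * dhb / (1 + dhb).
Proof.
  intros (Ht & Hr & _) Hp Hh Hb Hs; split.
  - now apply (hausdorff_lower_bound nb r).
  - now apply (hull_upper_bound nb r s).
Qed.
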